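(* Let $\mathcal{E}$ be a finite-dimensional nilpotent evolution algebra over a field $\mathbb{F}$ of type $[n_1,\ldots,n_r]$, let $B$ be any natural basis of $\mathcal{E}$, and for $i=1,\ldots,r$ let $\mathcal{U}_i$ be the linear span of $$B_i=\{e\in B : e^2\in\mathrm{ann}^{i-1}(\mathcal{E}),\ e\notin\mathrm{ann}^{i-1}(\mathcal{E})\}.$$ Then for all $i=2,\ldots,r$, $$\mathcal{U}_i\oplus\mathcal{U}_1=\{x\in\mathrm{ann}^i(\mathcal{E}) : x\,\mathrm{ann}^{i-1}(\mathcal{E})=0\}.$$
   Context: An evolution algebra (finite-dimensional here) is an algebra $\mathcal{E}$ over $\mathbb{F}$ with a basis $\{e_1,\ldots,e_n\}$ (a natural basis) such that $e_je_k=0$ for $j\neq k$; it is automatically commutative, and need not be associative. For an algebra $\mathcal{A}$, $\mathrm{ann}(\mathcal{A})=\{x\in\mathcal{A}: x\mathcal{A}=\mathcal{A}x=0\}$, $\mathrm{ann}^0(\mathcal{A})=0$, and $\mathrm{ann}^i(\mathcal{A})$ is defined by $\mathrm{ann}^i(\mathcal{A})/\mathrm{ann}^{i-1}(\mathcal{A})=\mathrm{ann}(\mathcal{A}/\mathrm{ann}^{i-1}(\mathcal{A}))$. With $\mathcal{A}^1=\mathcal{A}$ and $\mathcal{A}^{k+1}=\sum_{j=1}^k\mathcal{A}^j\mathcal{A}^{k+1-j}$, $\mathcal{A}$ is nilpotent if $\mathcal{A}^m=0$ for some $m$, equivalently $\mathrm{ann}^r(\mathcal{A})=\mathcal{A}$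 for some $r$. The type of a finite-dimensional nilpotent algebra $\mathcal{A}$ is the sequence $[n_1,\ldots,n_r]$, where $r$ is the least natural number with $\mathrm{ann}^r(\mathcal{A})=\mathcal{A}$ and $n_i=\dim\mathrm{ann}^i(\mathcal{A})-\dim\mathrm{ann}^{i-1}(\mathcal{A})$. *)

(* Defs.v *)
From HB Require Import structures.
From mathcomp Require Import all_boot all_order all_algebra.
Set Implicit Arguments.
Unset Strict Implicit.
Unset Printing Implicit Defensive.
Import GRing.Theory.
Local Open Scope ring_scope.

(* A finite-dimensional, not necessarily associative or unital, algebra over F
   is a vectType F together with a bilinear product. *)

Definition ann_mod (F : fieldType) (E : vectType F)
    (mul : {bilinear E -> E -> E}) (I : {vspace E}) : {vspace E} :=
  (\bigcap_(i < \dim {:E})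
     (linfun (applyr mul (vbasis {:E})`_i) @^-1: I
      :&: linfun (mul (vbasis {:E})`_i) @^-1: I))%VS.

Lemma ann_modP (F : fieldType) (E : vectType F)
    (mul : {bilinear E -> E -> E}) (I : {vspace E}) (x : E) :
  reflect (forall y, mul x y \in I /\ mul y x \in I) (x \in ann_mod mul I).
Proof.
apply: (iffP idP) => [xA y|xI].
  have xb (i : 'I_(\dim {:E})) :
      mul x (vbasis {:E})`_i \in I /\ mul (vbasis {:E})`_i x \in I.
    move: xA; rewrite memvE => /subv_bigcapP/(_ i isT).
    rewrite -memvE => /memv_capP[].
    by rewrite -!memv_preim !lfunE.
  rewrite (coord_vbasis (memvf y)) linear_sumr linear_sumlz.
  by split; apply: memv_suml => i _; rewrite ?linearZl_LR ?linearZr_LR;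
     apply: memvZ; case: (xb i).
rewrite memvE; apply/subv_bigcapP => i _; rewrite -memvE.
by apply/memv_capP; rewrite -!memv_preim !lfunE; apply: xI.
Qed.

Definition ann (F : fieldType) (E : vectType F) (mul : {bilinear E -> E -> E})
  : {vspace E} := ann_mod mul 0%VS.

(* The preimage in E of ann (E / I) is ann_mod mul I: the class of x
   annihilates E / I iff x E and E x lie in I.  See ann_iterS_quotient. *)
Fixpoint ann_iter (F : fieldType) (E : vectType F)
    (mul : {bilinear E -> E -> E}) (i : nat) : {vspace E} :=
  if i is j.+1 then ann_mod mul (ann_iter mul j) else 0%VS.

Lemma ann_iter_sub (F : fieldType) (E : vectType F)
    (mul : {bilinear E -> E -> E}) (i : nat) :
  (ann_iter mul i <= ann_iter mul i.+1)%VS.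
Proof.
elim: i => [|i IHi]; first exact: sub0v.
apply/subvP => x /ann_modP xA; apply/ann_modP => y.
by have [xy yx] := xA y; split; apply: (subvP IHi).
Qed.

Lemma ann_iterS_quotient (F : fieldType) (E Q : vectType F)
    (mul : {bilinear E -> E -> E}) (mulQ : {bilinear Q -> Q -> Q})
    (p : 'Hom(E, Q)) (i : nat) :
    (forall x y, p (mul x y) = mulQ (p x) (p y)) ->
    limg p = fullv -> lker p = ann_iter mul i ->
  (p @: ann_iter mul i.+1)%VS = ann mulQ.
Proof.
move=> pM p_onto kerp.
have kP z : (z \in ann_iter mul i) = (p z \in 0%VS).
  by rewrite -kerp memv_ker memv0.
have pP (x : E) : (p x \in ann mulQ) = (x \in ann_iter mul i.+1).
  apply/ann_modP/ann_modP => [xQ y|xE y'].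
    by rewrite !kP !pM; apply: xQ.
  have: y' \in limg p by rewrite p_onto memvf.
  case/memv_imgP=> y _ ->; rewrite -!pM -!kP; apply: xE.
apply/vspaceP => q; apply/memv_imgP/idP => [[x xE ->]|qA]; first by rewrite pP.
have: q \in limg p by rewrite p_onto memvf.
by case/memv_imgP=> x _ def_q; exists x; rewrite // -pP -def_q.
Qed.

Definition prod_space (F : fieldType) (E : vectType F)
    (mul : {bilinear E -> E -> E}) (U V : {vspace E}) : {vspace E} :=
  <<[seq mul u v | u <- vbasis U, v <- vbasis V]>>%VS.

Lemma prod_spaceP (F : fieldType) (E : vectType F)
    (mul : {bilinear E -> E -> E}) (U V W : {vspace E}) :
  reflect {in U & V, forall u v, mul u v \in W} (prod_space mul U V <= W)%VS.
Proof.
apply: (iffP idP) => [sW u v uU vV|inW]; last first.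
  apply/span_subvP => _ /allpairsP[[u v] [/vbasis_mem uU /vbasis_mem vV ->]].
  exact: inW.
apply: (subvP sW); rewrite (coord_vbasis uU) (coord_vbasis vV) linear_sumlz.
apply: memv_suml => j _; rewrite linear_sumr; apply: memv_suml => i _.
rewrite linearZl_LR linearZr_LR; do 2!apply: memvZ.
by apply/memv_span/allpairs_f; apply: mem_nth; rewrite size_tuple.
Qed.

(* [:: E^1; ...; E^n] *)
Fixpoint powers (F : fieldType) (E : vectType F)
    (mul : {bilinear E -> E -> E}) (n : nat) : seq {vspace E} :=
  if n is k.+1 then
    let s := powers mul k in
    rcons s (if k is 0 then fullv
             else (\sum_(j < k)
                     prod_space mul (nth 0 s j) (nth 0 s (k.-1 - j)))%VS)
  else [::].

(* Meaningful for 0 < k only. *)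
Definition power (F : fieldType) (E : vectType F)
    (mul : {bilinear E -> E -> E}) (k : nat) : {vspace E} :=
  nth 0%VS (powers mul k) k.-1.

Lemma size_powers (F : fieldType) (E : vectType F)
    (mul : {bilinear E -> E -> E}) (n : nat) : size (powers mul n) = n.
Proof. by elim: n => //= n IHn; rewrite size_rcons IHn. Qed.

Lemma nth_powers (F : fieldType) (E : vectType F)
    (mul : {bilinear E -> E -> E}) (n j : nat) :
  (j < n)%N -> nth 0%VS (powers mul n) j = power mul j.+1.
Proof.
elim: n => // n IHn; rewrite ltnS leq_eqVlt => /predU1P[-> //|j_lt_n].
by rewrite /= nth_rcons size_powers j_lt_n IHn.
Qed.

Lemma power1 (F : fieldType) (E : vectType F) (mul : {bilinear E -> E -> E}) :
  power mul 1 = fullv.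
Proof. by []. Qed.

Lemma powerS (F : fieldType) (E : vectType F)
    (mul : {bilinear E -> E -> E}) (k : nat) :
  (0 < k)%N ->
  power mul k.+1 =
    (\sum_(1 <= j < k.+1) prod_space mul (power mul j) (power mul (k.+1 - j)))%VS.
Proof.
case: k => // k _; rewrite {1}/power [powers _ _]/=.
rewrite nth_rcons size_rcons size_powers ltnn eqxx.
rewrite big_add1 /= big_mkord; apply: eq_bigr => j _.
have jk : (j <= k)%N by rewrite -ltnS.
rewrite -/(powers mul k.+1) !nth_powers //; last by rewrite ltnS leq_subr.
by rewrite -subSn.
Qed.

Definition nilpotent_algebra (F : fieldType) (E : vectType F)
    (mul : {bilinear E -> E -> E}) : Prop :=
  exists2 m : nat, (0 < m)%N & power mul m = 0%VS.

(* The truncated subtraction is harmless by ann_iter_sub. *)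
Definition algebra_type (F : fieldType) (E : vectType F)
    (mul : {bilinear E -> E -> E}) (n_ : seq nat) : Prop :=
  [/\ ann_iter mul (size n_) = fullv,
      forall k : nat, ann_iter mul k = fullv -> (size n_ <= k)%N
    & forall i : nat, (1 <= i <= size n_)%N ->
        nth 0%N n_ i.-1 = (\dim (ann_iter mul i) - \dim (ann_iter mul i.-1))%N].

Definition natural_basis (F : fieldType) (E : vectType F)
    (mul : {bilinear E -> E -> E}) (B : seq E) : Prop :=
  basis_of {:E} B /\ {in B &, forall e f, e != f -> mul e f = 0}.

Definition evolution_algebra (F : fieldType) (E : vectType F)
    (mul : {bilinear E -> E -> E}) : Prop :=
  exists B : seq E, natural_basis mul B.

Definition basis_layer (F : fieldType) (E : vectType F)
    (mul : {bilinear E -> E -> E}) (B : seq E) (i : nat) : seq E :=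
  [seq e <- B | (mul e e \in ann_iter mul i.-1)
                  && (e \notin ann_iter mul i.-1)].

Definition layer_span (F : fieldType) (E : vectType F)
    (mul : {bilinear E -> E -> E}) (B : seq E) (i : nat) : {vspace E} :=
  <<basis_layer mul B i>>%VS.

(* Main.v *)
Require Import Defs.
From mathcomp Require Import all_boot all_order all_algebra.

(** In coordinates over a natural basis, [x e = x_e e^2].  Hence [x] lies in
    [ann^i] iff every basis vector in its support does, and a basis vector [e]
    lies in [ann^(i+1)] iff [e^2] lies in [ann^i].  So the layer [B_i] is
    [B] intersected with [ann^i] minus [ann^(i-1)], and for [x] in [ann^i] the
    condition [x ann^(i-1) = 0] says that the basis vectors of the support
    lying in [ann^(i-1)] have square zero, i.e. belong to [B_1]. *)

Import GRing.Theory.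

Local Open Scope ring_scope.

Section NaturalBasis.

Set Implicit Arguments.
Unset Strict Implicit.

Lemma memv_span_filterP (F : fieldType) (E : vectType F) (B : seq E)
    (p : pred E) (x : E) :
  basis_of {:E} B ->
  reflect (forall j : 'I_(size B), coord (in_tuple B) j x != 0 -> p B`_j)
          (x \in <<[seq e <- B | p e]>>%VS).
Proof.
move=> basB; have freeB := basis_free basB.
apply: (iffP idP) => [xp j | supp_p].
  apply: contraNT => pj.
  suff /subvP/(_ x xp): (<<[seq e <- B | p e]>> <=
      lker (linfun (coord (in_tuple B) j : E -> F^o)))%VS.
    by rewrite memv_ker lfunE.
  apply/span_subvP => e; rewrite mem_filter => /andP[pe /(nthP 0)[k ltkB def_e]].
  rewrite memv_ker lfunE /= -def_e.
  rewrite (coord_free (Ordinal ltkB) j (freeB : free (in_tuple B))).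
  have [def_j | _] := eqVneq (Ordinal ltkB) j; last exact: eqxx.
  by case/negP: pj; rewrite -def_j def_e.
rewrite (coord_basis (basB : basis_of _ (in_tuple B)) (memvf x)).
apply: memv_suml => j _.
have [-> | /supp_p pj] := eqVneq (coord (in_tuple B) j x) 0.
  by rewrite scale0r mem0v.
by rewrite memvZ // memv_span // mem_filter pj mem_nth.
Qed.

Lemma mem_ann_iter_leq (F : fieldType) (E : vectType F)
    (mul : {bilinear E -> E -> E}) (i k : nat) (x : E) :
  (i <= k)%N -> x \in ann_iter mul i -> x \in ann_iter mul k.
Proof.
move=> /subnK <- xi; elim: (k - i)%N => // m xm.
by rewrite addSn (subvP (ann_iter_sub mul _)).
Qed.

Variables (F : fieldType) (E : vectType F) (mul : {bilinear E -> E -> E}).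
Variables (B : seq E) (natB : natural_basis mul B).

Let basB : basis_of {:E} (in_tuple B) := natB.1.
Let uniqB : uniq B := free_uniq (basis_free basB).

Lemma natural_basis_mulr (x : E) (j : 'I_(size B)) :
  mul x B`_j = coord (in_tuple B) j x *: mul B`_j B`_j.
Proof.
rewrite {1}(coord_basis basB (memvf x)) linear_sumlz (bigD1 j) //= linearZl_LR.
rewrite big1 ?addr0 // => k neq_kj.
by rewrite linearZl_LR natB.2 ?scaler0 ?mem_nth // nth_uniq.
Qed.

Lemma natural_basis_mull (x : E) (j : 'I_(size B)) :
  mul B`_j x = coord (in_tuple B) j x *: mul B`_j B`_j.
Proof.
rewrite {1}(coord_basis basB (memvf x)) linear_sumr (bigD1 j) //= linearZr_LR.
rewrite big1 ?addr0 // => k neq_kj.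
by rewrite linearZr_LR natB.2 ?scaler0 ?mem_nth // nth_uniq // eq_sym.
Qed.

Lemma natural_basis_mul (x y : E) :
  mul x y = \sum_(j < size B)
    (coord (in_tuple B) j x * coord (in_tuple B) j y) *: mul B`_j B`_j.
Proof.
rewrite {1}(coord_basis basB (memvf x)) linear_sumlz; apply: eq_bigr => j _.
by rewrite linearZl_LR (natural_basis_mull y) scalerA.
Qed.

Lemma ann_iterS_coordP (i : nat) (x : E) :
  reflect (forall j : 'I_(size B), coord (in_tuple B) j x != 0 ->
             mul B`_j B`_j \in ann_iter mul i)
          (x \in ann_iter mul i.+1).
Proof.
apply: (iffP (ann_modP mul (ann_iter mul i) x)) => [xA j nz_xj | xA y].
  have [+ _] := xA B`_j; rewrite natural_basis_mulr.
  move=> /(memvZ (coord (in_tuple B) j x)^-1).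
  by rewrite scalerA mulVf // scale1r.
rewrite (natural_basis_mul x y) (natural_basis_mul y x).
split; apply: memv_suml => j _.
  have [-> | /xA sqj] := eqVneq (coord (in_tuple B) j x) 0.
    by rewrite mul0r scale0r mem0v.
  exact: memvZ.
have [-> | /xA sqj] := eqVneq (coord (in_tuple B) j x) 0.
  by rewrite mulr0 scale0r mem0v.
exact: memvZ.
Qed.

(** Every product with a basis vector [e] is a multiple of [e^2]. This turns the condition on
    squares that defines the layers into membership in the annihilator series. *)
Lemma natural_basis_sq_ann (i : nat) (e : E) :
  e \in B -> (mul e e \in ann_iter mul i) = (e \in ann_iter mul i.+1).
Proof.
case/(nthP 0) => k ltkB <-; pose j := Ordinal ltkB.
apply/idP/ann_modP => [sq_e y | /(_ B`_k)[] //].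
by rewrite (natural_basis_mulr y j) (natural_basis_mull y j); split; apply: memvZ.
Qed.

(** Each [ann^i] is thus spanned by the basis vectors it contains; for [i = 0] the support of [x] is
    empty. *)
Lemma ann_iter_coord (i : nat) (x : E) (j : 'I_(size B)) :
  x \in ann_iter mul i -> coord (in_tuple B) j x != 0 ->
  B`_j \in ann_iter mul i.
Proof.
case: i => [|i]; first by rewrite memv0 => /eqP->; rewrite linear0 eqxx.
by move=> /ann_iterS_coordP xA /xA; rewrite natural_basis_sq_ann ?mem_nth.
Qed.

Lemma layer_spanP (i : nat) (x : E) :
  reflect (forall j : 'I_(size B), coord (in_tuple B) j x != 0 ->
             (B`_j \in ann_iter mul i.+1) && (B`_j \notin ann_iter mul i))
          (x \in layer_span mul B i.+1).
Proof.
apply: (iffP (memv_span_filterP _ _ natB.1)) => xL j /xL /=;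
by rewrite natural_basis_sq_ann ?mem_nth.
Qed.

(** The two layers are disjoint: [B_1] lies in [ann^1], hence in [ann^i] since [0 < i], whereas
    [B_(i+1)] avoids [ann^i]. A common vector therefore has empty support. *)
Lemma layer_span_directv (i : nat) :
  (0 < i)%N -> directv (layer_span mul B i.+1 + layer_span mul B 1)%VS.
Proof.
move=> i_gt0; apply/directv_addP/eqP; rewrite -subv0; apply/subvP => x.
rewrite memv_cap memv0 => /andP[/layer_spanP xi /layer_spanP x1].
rewrite (coord_basis basB (memvf x)) big1 // => j _.
have [-> | nz_xj] := eqVneq (coord (in_tuple B) j x) 0; first exact: scale0r.
have /andP[_ /negP[]] := xi j nz_xj.
by have /andP[/(mem_ann_iter_leq i_gt0)] := x1 j nz_xj.
Qed.

Lemma layer_span_addP (i : nat) (x : E) :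
  reflect (forall j : 'I_(size B), coord (in_tuple B) j x != 0 ->
             (B`_j \in ann_iter mul i.+1) && (B`_j \notin ann_iter mul i)
             || (B`_j \in ann_iter mul 1))
          (x \in (layer_span mul B i.+1 + layer_span mul B 1)%VS).
Proof.
(* For [B_1] the excluded space is [ann^0 = 0], so its second condition holds for every basis vector
   and drops out of the criterion. *)
have nzB e : e \in B -> e != 0 by apply: (free_not0 (basis_free basB)).
pose p i e := (mul e e \in ann_iter mul i) && (e \notin ann_iter mul i).
have -> : (layer_span mul B i.+1 + layer_span mul B 1)%VS
    = <<[seq e <- B | p i e || p 0%N e]>>%VS.
  rewrite -span_cat; apply: eq_span => e.
  by rewrite mem_cat !mem_filter -andb_orl.
apply: (iffP (memv_span_filterP _ _ natB.1)) => xL j /xL;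
  rewrite /p !natural_basis_sq_ann ?mem_nth // memv0;
  by rewrite nzB ?mem_nth // andbT.
Qed.

End NaturalBasis.

Theorem proposition3p5 (F : fieldType) (E : vectType F)
    (mul : {bilinear E -> E -> E}) (n_ : seq nat) (B : seq E)
    (hevol : evolution_algebra mul) (hnil : nilpotent_algebra mul)
    (htype : algebra_type mul n_) (hB : natural_basis mul B) :
  forall i : nat, (2 <= i <= size n_)%N ->
    directv (layer_span mul B i + layer_span mul B 1)%VS /\
    (forall x : E,
       x \in (layer_span mul B i + layer_span mul B 1)%VS <->
       x \in ann_iter mul i /\
       (forall y : E, y \in ann_iter mul i.-1 -> mul x y = 0)).
Proof.
(* From here [i] is the predecessor of the index in the statement: the layer is [B_(i+1)] and the
   annihilated space is [ann^i]. *)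
case=> // i /andP[i_gt0 _]; split; first exact: layer_span_directv.
move=> x; split=> [/(layer_span_addP hB) xL | [xA xann]].
  split=> [|y yA].
    apply/(ann_iterS_coordP hB) => j /xL.
    rewrite (natural_basis_sq_ann hB) ?mem_nth // => /orP[/andP[] // |].
    exact: mem_ann_iter_leq.
  (* A term with [x_j] and [y_j] both nonzero has [B_j] in [ann^i], because [y] is; this rules out
     [B_(i+1)], so [B_j] is in [B_1] and its square is 0. *)
  rewrite (natural_basis_mul hB) big1 // => j _.
  have [-> | /xL] := eqVneq (coord (in_tuple B) j x) 0.
    by rewrite mul0r scale0r.
  have [-> _ | nz_yj] := eqVneq (coord (in_tuple B) j y) 0.
    by rewrite mulr0 scale0r.
  rewrite (ann_iter_coord hB yA nz_yj) andbF orFb.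
  rewrite -(natural_basis_sq_ann hB) ?mem_nth // memv0 => /eqP->.
  exact: scaler0.
apply/(layer_span_addP hB) => j nz_xj; rewrite (ann_iter_coord hB xA nz_xj).
(* Outside [ann^i], [B_j] belongs to [B_(i+1)]. Inside, it is itself a legitimate test vector:
   [x B_j = x_j B_j^2 = 0] forces [B_j^2 = 0]. *)
have [Bj_ann | //] := boolP (B`_j \in ann_iter mul i); rewrite andbF orFb.
rewrite -(natural_basis_sq_ann hB) ?mem_nth // memv0.
move: (xann _ Bj_ann); rewrite (natural_basis_mulr hB) => /eqP.
by rewrite scaler_eq0 (negbTE nz_xj).
Qed.
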